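(* Let $n$ be a positive integer and let $Z$ be a nonempty closed subset of $\mathbb R^n$ (Euclidean topology) satisfying $\mathbb R_{\ge 0}Z=Z$, where $\mathbb R_{\ge0}Z=\{t\boldsymbol p\in\mathbb R^n\mid t\in\mathbb R_{\ge0},\ \boldsymbol p\in Z\}$. Then $\mathbf V(\mathbf E(Z)_{\mathbb B})=Z$.
   Context: $\mathbb B=\{0,-\infty\}$ is the Boolean semifield, with addition $\max$ and multiplication the usual $+$. $\mathbb B[\boldsymbol x^{\pm}]=\mathbb B[x_1^\pm,\dots,x_n^\pm]$ is the Laurent polynomial semiring over $\mathbb B$; its elements are finite formal sums $\bigoplus_{i=1}^m\boldsymbol x^{\boldsymbol u_i}$ with $\boldsymbol u_i\in\mathbb Z^n$ (the empty sum being the zero element $-\infty$). Such an element defines the function $\boldsymbol p\mapsto\max_i\{\boldsymbol u_i\cdot\boldsymbol p\}$ on $\mathbb R^n$, where $\cdot$ is the standard inner product (the zero polynomial defines the constant function $-\infty$). $\mathbb B[\boldsymbol x^\pm]_{\mathrm{fcn}}$ is the quotient of $\mathbb B[\boldsymbol x^\pm]$ identifying polynomials that define the same function on $\mathbb R^n$; equivalently, it is the semiring of functions on $\mathbb R^n$ defined by Boolean Laurent polynomials, with pointwise $\max$ and $+$. A congruence on a semiring is an equivalence relation compatible with addition and multiplication. For $Z\subset\mathbb R^n$, $\mathbf E(Z)_{\mathbb B}=\{(f,g)\in(\mathbb B[\boldsymbol x^\pm]_{\mathrm{fcn}})^2\mid f|_Z=g|_Z\}$, a congruence on $\mathbb B[\boldsymbol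 x^\pm]_{\mathrm{fcn}}$. For a congruence $E$ on $\mathbb B[\boldsymbol x^\pm]_{\mathrm{fcn}}$, $\mathbf V(E)=\{\boldsymbol p\in\mathbb R^n\mid f(\boldsymbol p)=g(\boldsymbol p)\text{ for all }(f,g)\in E\}$. *)

(* Defs.v *)
From HB Require Import structures.
From mathcomp Require Import all_boot all_order all_algebra finmap.
From mathcomp Require Import all_classical all_reals all_analysis.
Import Order.TTheory GRing.Theory Num.Theory.
Import numFieldNormedType.Exports.

Set Implicit Arguments.
Unset Strict Implicit.
Unset Printing Implicit Defensive.

Local Open Scope classical_set_scope.
Local Open Scope ring_scope.

Definition dotz (R : realType) (n : nat) (u : 'rV[int]_n) (p : 'rV[R]_n) : R :=
  \sum_(i < n) (u 0 i)%:~R * p 0 i.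

(* A coefficient in the Boolean semifield {0, -oo} only records whether the
   monomial occurs, so a Laurent polynomial is its finite set of exponents;
   the sum of polynomials is the union, the product is the Minkowski sum. *)
Definition blaurent (n : nat) := {fset 'rV[int]_n}.

Definition blaurent_add (n : nat) (P Q : blaurent n) : blaurent n :=
  (P `|` Q)%fset.

Definition blaurent_mul (n : nat) (P Q : blaurent n) : blaurent n :=
  [fset (u + v)%R | u in P, v in Q]%fset.

(* Values lie in R \cup {-oo}; -oo is the value of the empty maximum. *)
Definition blaurent_eval (R : realType) (n : nat) (P : blaurent n)
    (p : 'rV[R]_n) : \bar R :=
  \big[Order.max/-oo%E]_(u <- P) (dotz u p)%:E.

Section EvalTheory.
Context {R : realType} {n : nat}.
Implicit Types (P Q : blaurent n) (p : 'rV[R]_n) (y : \bar R).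

Lemma dotzD (u v : 'rV[int]_n) p : dotz (u + v) p = dotz u p + dotz v p.
Proof.
rewrite /dotz -big_split /=; apply: eq_bigr => i _.
by rewrite mxE intrD mulrDl.
Qed.

Lemma dotz0 p : dotz 0 p = 0.
Proof. by rewrite /dotz big1 // => i _; rewrite mxE mul0r. Qed.

Lemma le_blaurent_eval P u p :
  u \in P -> ((dotz u p)%:E <= blaurent_eval P p)%E.
Proof.
by move=> uP; exact: (@le_bigmax_seq _ _ _ _ _ _ xpredT
  (fun u => (dotz u p)%:E) uP).
Qed.

Lemma blaurent_eval_le P p y :
  (forall u, u \in P -> ((dotz u p)%:E <= y)%E) -> (blaurent_eval P p <= y)%E.
Proof.
move=> Py; rewrite /blaurent_eval big_seq_cond.
by apply: bigmax_le => [|u /andP[uP _]]; [exact: leNye|exact: Py].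
Qed.

Lemma blaurent_eval0 p : blaurent_eval fset0 p = -oo%E.
Proof.
by apply/eqP; rewrite -leeNy_eq; apply: blaurent_eval_le => u; rewrite in_fset0.
Qed.

Lemma blaurent_eval1 p : blaurent_eval [fset 0]%fset p = 0%E.
Proof.
apply/eqP; rewrite eq_le; apply/andP; split.
- by apply: blaurent_eval_le => u; rewrite in_fset1 => /eqP ->; rewrite dotz0.
- by rewrite -[leLHS]/(0%:E) -(dotz0 p); apply: le_blaurent_eval; rewrite in_fset1.
Qed.

Lemma blaurent_evalD P Q p :
  blaurent_eval (blaurent_add P Q) p =
  Order.max (blaurent_eval P p) (blaurent_eval Q p).
Proof.
apply/eqP; rewrite eq_le ge_max; apply/and3P; split.
- apply: blaurent_eval_le => u; rewrite in_fsetU le_max => /orP[uP|uQ].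
  + by rewrite le_blaurent_eval.
  + by rewrite (le_blaurent_eval p uQ) orbT.
- by apply: blaurent_eval_le => u uP; apply: le_blaurent_eval;
    rewrite in_fsetU uP.
- by apply: blaurent_eval_le => u uQ; apply: le_blaurent_eval;
    rewrite in_fsetU uQ orbT.
Qed.

Lemma adde_bigmaxr (I : Type) (s : seq I) (F : I -> \bar R) (x : \bar R) :
  x != +oo%E ->
  (x + \big[Order.max/-oo]_(i <- s) F i)%E =
  \big[Order.max/-oo%E]_(i <- s) (x + F i)%E.
Proof.
move=> xy; elim: s => [|i s IH]; first by rewrite !big_nil; case: x xy.
by rewrite !big_cons -IH adde_maxr.
Qed.

Lemma blaurent_eval_neqy P p : blaurent_eval P p != +oo%E.
Proof.
by rewrite /blaurent_eval; apply: (big_ind (fun x => x != +oo%E)) => // x y;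
  rewrite /Order.max; case: ifP.
Qed.

Lemma blaurent_evalM P Q p :
  blaurent_eval (blaurent_mul P Q) p =
  (blaurent_eval P p + blaurent_eval Q p)%E.
Proof.
apply/eqP; rewrite eq_le; apply/andP; split.
- apply: blaurent_eval_le => _ /imfset2P[u uP [v vQ ->]].
  by rewrite dotzD EFinD; apply: leeD; exact: le_blaurent_eval.
- rewrite {2}/blaurent_eval adde_bigmaxr ?blaurent_eval_neqy//.
  rewrite big_seq_cond; apply: bigmax_le => [|v /andP[vQ _]]; first exact: leNye.
  rewrite addeC /blaurent_eval adde_bigmaxr// big_seq_cond.
  apply: bigmax_le => [|u /andP[uP _]]; first exact: leNye.
  rewrite -EFinD addrC -dotzD; apply: le_blaurent_eval.
  by apply/imfset2P; exists u => //; exists v.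
Qed.

End EvalTheory.

(* The quotient of the Laurent polynomials identifying those that define the
   same function, realised as the semiring of the functions they define. *)
Record bfcn (R : realType) (n : nat) := BFcn {
  bfcn_val :> 'rV[R]_n -> \bar R;
  bfcn_valP : `[< exists P : blaurent n, bfcn_val = blaurent_eval P >] }.

HB.instance Definition _ (R : realType) (n : nat) :=
  [isSub for @bfcn_val R n].
HB.instance Definition _ (R : realType) (n : nat) :=
  [Choice of bfcn R n by <:].

Section FcnSemiring.
Context {R : realType} {n : nat}.
Implicit Types f g h : bfcn R n.

Lemma bfcn_ext f g : f =1 g -> f = g.
Proof. by move=> fg; apply/val_inj/funext. Qed.

Lemma bfcn_zero_subproof :
  `[< exists P : blaurent n,
        (fun _ : 'rV[R]_n => -oo%E) = blaurent_eval P >].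
Proof.
by apply/asboolP; exists fset0; apply/funext => p; rewrite blaurent_eval0.
Qed.

Lemma bfcn_one_subproof :
  `[< exists P : blaurent n,
        (fun _ : 'rV[R]_n => 0%E) = blaurent_eval P >].
Proof.
by apply/asboolP; exists [fset 0]%fset; apply/funext => p;
  rewrite blaurent_eval1.
Qed.

Lemma bfcn_add_subproof f g :
  `[< exists P : blaurent n,
        (fun p : 'rV[R]_n => Order.max (f p) (g p)) = blaurent_eval P >].
Proof.
have [/asboolP[P fP] /asboolP[Q gQ]] := (bfcn_valP f, bfcn_valP g).
apply/asboolP; exists (blaurent_add P Q); apply/funext => p.
by rewrite blaurent_evalD fP gQ.
Qed.

Lemma bfcn_mul_subproof f g :
  `[< exists P : blaurent n,
        (fun p : 'rV[R]_n => (f p + g p)%E) = blaurent_eval P >].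
Proof.
have [/asboolP[P fP] /asboolP[Q gQ]] := (bfcn_valP f, bfcn_valP g).
apply/asboolP; exists (blaurent_mul P Q); apply/funext => p.
by rewrite blaurent_evalM fP gQ.
Qed.

Definition bfcn_zero : bfcn R n := BFcn bfcn_zero_subproof.
Definition bfcn_one : bfcn R n := BFcn bfcn_one_subproof.
Definition bfcn_add f g : bfcn R n := BFcn (bfcn_add_subproof f g).
Definition bfcn_mul f g : bfcn R n := BFcn (bfcn_mul_subproof f g).

Lemma bfcn_addA : associative bfcn_add.
Proof. by move=> f g h; apply: bfcn_ext => p /=; rewrite maxA. Qed.

Lemma bfcn_addC : commutative bfcn_add.
Proof. by move=> f g; apply: bfcn_ext => p /=; rewrite maxC. Qed.

Lemma bfcn_add0 : left_id bfcn_zero bfcn_add.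
Proof. by move=> f; apply: bfcn_ext => p /=; apply/max_idPr; exact: leNye. Qed.

Lemma bfcn_mulA : associative bfcn_mul.
Proof. by move=> f g h; apply: bfcn_ext => p /=; rewrite addeA. Qed.

Lemma bfcn_mulC : commutative bfcn_mul.
Proof. by move=> f g; apply: bfcn_ext => p /=; rewrite addeC. Qed.

Lemma bfcn_mul1 : left_id bfcn_one bfcn_mul.
Proof. by move=> f; apply: bfcn_ext => p /=; rewrite add0e. Qed.

Lemma bfcn_mulD : left_distributive bfcn_mul bfcn_add.
Proof. by move=> f g h; apply: bfcn_ext => p /=; rewrite -adde_maxl. Qed.

Lemma bfcn_mul0 : left_zero bfcn_zero bfcn_mul.
Proof. by move=> f; apply: bfcn_ext. Qed.

Lemma bfcn_oner_neq0 : bfcn_one != bfcn_zero.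
Proof.
by apply/eqP => /(congr1 (fun f : bfcn R n => f 0)).
Qed.

HB.instance Definition _ :=
  GRing.isNmodule.Build (bfcn R n) bfcn_addA bfcn_addC bfcn_add0.
HB.instance Definition _ :=
  GRing.Nmodule_isComNzSemiRing.Build (bfcn R n)
    bfcn_mulA bfcn_mulC bfcn_mul1 bfcn_mulD bfcn_mul0 bfcn_oner_neq0.

Lemma bfcn_addE f g p : (f + g) p = Order.max (f p) (g p).
Proof. by []. Qed.

Lemma bfcn_mulE f g p : (f * g) p = (f p + g p)%E.
Proof. by []. Qed.

End FcnSemiring.

Record congruence (S : pzSemiRingType) := Congruence {
  cong_set : set (S * S);
  cong_refl : forall f, cong_set (f, f);
  cong_sym : forall f g, cong_set (f, g) -> cong_set (g, f);
  cong_trans : forall f g h,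
    cong_set (f, g) -> cong_set (g, h) -> cong_set (f, h);
  cong_add : forall f g f' g',
    cong_set (f, g) -> cong_set (f', g') -> cong_set (f + f', g + g');
  cong_mul : forall f g f' g',
    cong_set (f, g) -> cong_set (f', g') -> cong_set (f * f', g * g') }.

Section VanishingCongruence.
Context {R : realType} {n : nat}.

Definition EB_set (Z : set 'rV[R]_n) : set (bfcn R n * bfcn R n) :=
  [set fg : bfcn R n * bfcn R n | forall p, Z p -> fg.1 p = fg.2 p].

Definition EB (Z : set 'rV[R]_n) : congruence (bfcn R n).
Proof.
refine (@Congruence _ (EB_set Z) _ _ _ _ _) => //.
- by move=> f g fg p pZ; rewrite /= fg.
- by move=> f g h fg gh p pZ; rewrite /= fg// gh.
- by move=> f g f' g' fg fg' p pZ; rewrite !bfcn_addE fg// fg'.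
- by move=> f g f' g' fg fg' p pZ; rewrite !bfcn_mulE fg// fg'.
Defined.

Definition VB (E : congruence (bfcn R n)) : set 'rV[R]_n :=
  [set p | forall fg : bfcn R n * bfcn R n, cong_set E fg -> fg.1 p = fg.2 p].

Definition nneg_dilates (Z : set 'rV[R]_n) : set 'rV[R]_n :=
  [set q | exists t : R, exists p : 'rV[R]_n,
     [/\ 0 <= t, Z p & q = t *: p]].

End VanishingCongruence.

(* Main.v *)
Require Import Defs.
From mathcomp Require Import all_boot all_order all_algebra.
From mathcomp Require Import all_classical all_reals all_analysis.
From mathcomp Require Import finmap lra.
Import Order.TTheory GRing.Theory Num.Theory.
Import numFieldNormedType.Exports.
Local Open Scope classical_set_scope.
Local Open Scope ring_scope.

(** The inclusion of [Z] in [VB (EB Z)] is formal.  Conversely, a point [p]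
outside [Z] must be separated from [Z] by a pair of Boolean polynomials that
agree on [Z] and differ at [p].

If [g] is the sum of the monomials with exponents in a finite set [W], then
[1 + g] and [g] differ exactly where all the [w] in [W] are negative, since
there the first function is [0] and the second is not; so they differ exactly
on the open rational polyhedral cone cut out by the inequalities
[dotz w q < 0] (lemma [negative_cone_notin_VB]).  Hence it is enough to find
such a cone that contains [p] and misses [Z].

As [Z] contains the origin, [p] is nonzero; as [Z] is closed, it misses a ball
around [p]; as [Z] is stable under dilation, it misses the whole open cone
spanned by this ball.  Finally, rational polyhedral cones are fine enough to fit
around the ray of [p] inside that cone: choose an integer vector [v] positive
at [p], and enclose the ratio of each coordinate to the value of [v], as taken
at [p], in an open rational interval of length [2 / N]; clearing denominators
turns these constraints into linear inequalities with integer coefficients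
(lemma [rational_cone_nbhs]). *)

Section Dotz.
Context {R : realType} {n : nat}.
Implicit Types (u v w : 'rV[int]_n) (p q : 'rV[R]_n).

Lemma dotzZ (a : int) u p : dotz (a *: u) p = a%:~R * dotz u p.
Proof.
by rewrite /dotz mulr_sumr; apply: eq_bigr => i _; rewrite mxE intrM mulrA.
Qed.

Lemma dotzN u p : dotz (- u) p = - dotz u p.
Proof. by rewrite -scaleN1r dotzZ mulN1r. Qed.

Lemma dotzB u v p : dotz (u - v) p = dotz u p - dotz v p.
Proof. by rewrite dotzD dotzN. Qed.

Lemma dotz_delta i p : dotz (delta_mx 0 i) p = p 0 i.
Proof.
rewrite /dotz (bigD1 i)//= mxE !eqxx mul1r big1 ?addr0// => j ji.
by rewrite mxE (negbTE ji) andbF mul0r.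
Qed.

Lemma dotz_gt0_exists p : p != 0 -> exists v, 0 < dotz v p.
Proof.
move=> p0; have [k pk] : exists k, p 0 k != 0.
  apply/not_existsP => pk; case/eqP: p0; apply/rowP => k.
  by rewrite mxE; apply/eqP/negPn/negP/pk.
have [pk0|pk0|/eqP] := ltgtP (p 0 k) 0; last by rewrite (negbTE pk).
- by exists (- delta_mx 0 k); rewrite dotzN dotz_delta oppr_gt0.
- by exists (delta_mx 0 k); rewrite dotz_delta.
Qed.

(** With [v] positive at [p], the condition [dotz w q < 0] for the exponents
[w] below says that [dotz v q > 0] and that each [N * q 0 i] lies strictly
between [(m i - 1) * dotz v q] and [(m i + 1) * dotz v q].  Rescaled so that
[v] takes the value [dotz v p], such a [q] is within [2 * dotz v p / N] of [p]
when [m i] is the integer part of [N * p 0 i / dotz v p]; taking [m i - 1] as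
the lower end keeps [p] strictly inside when that number is an integer. *)
Lemma rational_cone_nbhs p (e : R) : p != 0 -> 0 < e ->
  exists W : blaurent n,
    (forall w, w \in W -> dotz w p < 0) /\
    forall q, (forall w, w \in W -> dotz w q < 0) ->
      exists2 c : R, 0 < c & forall i, `|p 0 i - (c *: q) 0 i| < e.
Proof.
move=> /dotz_gt0_exists[v]; set T := dotz v p => T0 e0.
pose N := (Num.truncn (2 * T / e)).+1.
have Ne : 2 * T < N%:R * e by rewrite -ltr_pdivrMr// truncnS_gt.
have N0 : 0 < N%:R :> R by rewrite ltr0n.
pose m i : int := Num.floor (N%:R * p 0 i / T).
have m_le i : (m i)%:~R * T <= N%:R * p 0 i.
  by rewrite -ler_pdivlMr// floor_le.
have m_gt i : N%:R * p 0 i < ((m i)%:~R + 1) * T.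
  by rewrite -ltr_pdivrMr// -[1]/(1%:~R) -intrD floorD1_gt.
pose lo i : 'rV[int]_n := (m i - 1) *: v - N%:Z *: delta_mx 0 i.
pose hi i : 'rV[int]_n := N%:Z *: delta_mx 0 i - (m i + 1) *: v.
have loE i q : dotz (lo i) q = ((m i)%:~R - 1) * dotz v q - N%:R * q 0 i.
  by rewrite /lo dotzB !dotzZ dotz_delta intrB.
have hiE i q : dotz (hi i) q = N%:R * q 0 i - ((m i)%:~R + 1) * dotz v q.
  by rewrite /hi dotzB !dotzZ dotz_delta intrD.
pose W : blaurent n :=
  ((- v) |` ([fset lo i | i in 'I_n] `|` [fset hi i | i in 'I_n]))%fset.
exists W; split.
- move=> w; rewrite in_fset1U in_fsetU => /or3P[/eqP->|/imfsetP|/imfsetP].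
  + by rewrite dotzN oppr_lt0.
  + move=> [i _ ->]; rewrite loE -/T; have := m_le i; lra.
  + by move=> [i _ ->]; rewrite hiE subr_lt0.
- move=> q Wq; set D := dotz v q.
  have D0 : 0 < D by rewrite -oppr_lt0 -dotzN Wq// in_fset1U eqxx.
  exists (T / D) => [|i]; first exact: divr_gt0.
  have cD : T / D * D = T by rewrite divfK ?gt_eqF.
  have c0 : 0 < T / D by exact: divr_gt0.
  have /(Wq _) : lo i \in W.
    by rewrite in_fset1U in_fsetU in_imfset ?orbT.
  have /(Wq _) : hi i \in W.
    by rewrite in_fset1U in_fsetU (in_imfset _ hi) ?orbT.
  rewrite loE hiE -/D !subr_lt0 -(ltr_pM2l c0) => qhi.
  rewrite -(ltr_pM2l c0) => qlo.
  rewrite mxE; move: (T / D) cD qhi qlo {c0} => c cD.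
  rewrite !(mulrCA c) cD => qhi qlo.
  have := m_le i; have := m_gt i => pm mp.
  (* both points are compared after multiplication by [N] *)
  rewrite -(ltr_pM2l N0) -{1}(gtr0_norm N0) -normrM.
  by apply: lt_trans Ne; rewrite mulrBr ltr_norml; apply/andP; split; lra.
Qed.

End Dotz.

Section Separation.
Context {R : realType} {n : nat}.

Lemma blaurent_fcn_subproof (P : blaurent n) :
  `[< exists Q : blaurent n,
        blaurent_eval P = blaurent_eval Q :> ('rV[R]_n -> \bar R) >].
Proof. by apply/asboolP; exists P. Qed.

Definition blaurent_fcn (P : blaurent n) : bfcn R n :=
  BFcn (blaurent_fcn_subproof P).

(** The pair [(1 + g, g)], where [g] has exponent set [W], lies in [EB Z]
because at each point of [Z] some monomial of [g] dominates the constant [1],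
whose value is [0]; at [p] every monomial of [g] is below it. *)
Lemma negative_cone_notin_VB (Z : set 'rV[R]_n) (W : blaurent n) p :
  (forall w, w \in W -> dotz w p < 0) ->
  (forall q, Z q -> exists2 w, w \in W & 0 <= dotz w q) ->
  ~ VB (EB Z) p.
Proof.
move=> Wp WZ VBp; pose g := blaurent_fcn W.
have /VBp/= : cong_set (EB Z) (1 + g, g).
  move=> q /WZ[w wW w0]; rewrite /= max_r//=.
  by apply: le_trans (le_blaurent_eval q wW); rewrite lee_fin.
have : (g p < 0)%E.
  rewrite /= /blaurent_eval big_seq; apply: bigmax_lt => [|w wW].
    exact: ltNy0.
  by rewrite lte_fin Wp.
by move=> gp0; rewrite max_l ?ltW// => gp; move: gp0; rewrite /= -gp ltxx.
Qed.

End Separation.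

Theorem theorem1p2 (R : realType) (n : nat) (n_gt0 : (0 < n)%N)
    (Z : set 'rV[R]_n) (Z_neq0 : Z !=set0) (Z_closed : closed Z)
    (Z_cone : nneg_dilates Z = Z) :
  VB (EB Z) = Z.
Proof.
have ZZ (t : R) q : 0 <= t -> Z q -> Z (t *: q).
  by move=> t0 Zq; rewrite -Z_cone; exists t, q.
apply/seteqP; split => [p VBp|p Zp fg]; last exact.
apply: contrapT => Zp.
have p0 : p != 0.
  apply/eqP => p0; have [q Zq] := Z_neq0.
  by apply: Zp; rewrite p0 -(scale0r q); exact: ZZ.
have /nbhs_ballP[e e0 pe] : nbhs p (~` Z).
  by apply: open_nbhs_nbhs; split => //; exact: closed_openC.
have [W [Wp Wcone]] := rational_cone_nbhs p e p0 e0.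
apply: (negative_cone_notin_VB Z W p Wp _ VBp) => q Zq.
apply: contrapT => Wq.
have [|c c0 cq] := Wcone q.
  by move=> w wW; rewrite ltNge; apply/negP => w0; apply: Wq; exists w.
apply: (pe (c *: q)); last by apply: ZZ => //; exact: ltW.
by split=> // i j; rewrite ord1; exact: cq.
Qed.
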